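(* Let $p(x,\mathbf{y})$ and $q(x,\mathbf{y})$ be terms in the language of power-set algebras, where $\mathbf{y}$ is a list of variables not containing $x$, and let $V$ be a variable different from $x$ and not in $\mathbf{y}$. The $V$-translation of $$(\exists x)\big[p(x,\mathbf{y}) = 0\ \wedge\ q(x,\mathbf{y})\neq 0\big]$$ is $$(\exists x)\big[p(x,\mathbf{y}) = 0\ \wedge\ V\cdot q(x,\mathbf{y})' = 0\big].$$ The complete result of eliminating $x$ from $p(x,\mathbf{y}) = 0\ \wedge\ V\cdot q(x,\mathbf{y})' = 0$ is (up to equivalence) the equation $$p(1,\mathbf{y})\cdot p(0,\mathbf{y})\ \cup\ V\cdot\Big(q(1,\mathbf{y})\cdot p(1,\mathbf{y})'\ \cup\ q(0,\mathbf{y})\cdot p(0,\mathbf{y})'\Big)' = 0;$$ that is, the existential formula $(\exists x)\big[p(x,\mathbf{y}) = 0\wedge V\cdot q(x,\mathbf{y})' = 0\big]$ is equivalent to this equation. This equation, which is equivalent to the conjunction of the equation $p(1,\mathbf{y})\cdot p(0,\mathbf{y}) = 0$ and the $V$-equation $V\cdot\big(q(1,\mathbf{y})\cdot p(1,\mathbf{y})'\cup q(0,\mathbf{y})\cdot p(0,\mathbf{y})'\big)' = 0$, translates back into $$\big[p(1,\mathbf{y})\cdot p(0,\mathbf{y}) = 0\big]\ \wedge\ \big[q(1,\mathbf{y})\cdot p(1,\mathbf{y})'\ \cup\ q(0,\mathbf{y})\cdot p(0,\mathbf{y})'\ \neq\ 0\big].$$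
   Context: Terms are built from variables and the constants $0,1$ using the operation symbols $\cup$, $\cap$ (also written $\cdot$ or juxtaposition) and $'$ (complement). For a nonempty set $U$, an interpretation into the power-set algebra of $U$ assigns to each variable a subset of $U$ and is extended to terms by reading $0$ as $\emptyset$, $1$ as $U$, and $\cup,\cap,{}'$ as union, intersection and complement in $U$; truth of first-order formulas under an interpretation is defined as usual, with quantifiers ranging over subsets of $U$. Two formulas are equivalent if they are true under exactly the same interpretations, over all nonempty sets $U$. $V$-translation: the two-way syntactic translation $t\neq 0\ \rightleftharpoons\ V\cdot t' = 0$ between negated equations and $V$-equations, where $V$ is a new variable; it is applied to the negated equation (respectively the $V$-equation) in a conjunction, leaving equations not involving $V$ unchanged. (The two sides of this translation are not equivalent formulas.) Elimination: for a term $P(x,\mathbf{z})$, the complete result of eliminating $x$ from the equation $P(x,\mathbf{z}) = 0$ is the equation $P(1,\mathbf{z})\cdot P(0,\mathbf{z}) = 0$, which is equivalent to $(\exists x)[P(x,\mathbf{z}) = 0]$. A conjunction of two equations $s=0\wedge t=0$ is first reduced to the single equation $s\cup t=0$. *)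

(* Defs.v *)
From mathcomp Require Import all_boot.
From mathcomp Require Import boolp classical_sets.

Set Implicit Arguments.
Unset Strict Implicit.
Unset Printing Implicit Defensive.

Inductive term : Type :=
| Var of nat
| Zero
| One
| Cup of term & term
| Cap of term & term
| Compl of term.

Inductive formula : Type :=
| Equal of term & term
| Not of formula
| And of formula & formula
| Or of formula & formula
| Implies of formula & formula
| Exists of nat & formula
| Forall of nat & formula.

Declare Scope pset_scope.
Delimit Scope pset_scope with P.
Bind Scope pset_scope with term.
Bind Scope pset_scope with formula.
Notation "0" := Zero : pset_scope.
Notation "1" := One : pset_scope.
Notation "s `|` t" := (Cup s t) : pset_scope.
Notation "s `&` t" := (Cap s t) : pset_scope.
Notation "~` t" := (Compl t) : pset_scope.
Notation "s == t" := (Equal s t) : pset_scope.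
Notation "s != t" := (Not (Equal s t)) : pset_scope.
Notation "f /\ g" := (And f g) : pset_scope.

Fixpoint eval (U : Type) (v : nat -> set U) (t : term) : set U :=
  match t with
  | Var z => v z
  | Zero => set0
  | One => setT
  | Cup s t => (eval v s `|` eval v t)%classic
  | Cap s t => (eval v s `&` eval v t)%classic
  | Compl s => (~` eval v s)%classic
  end.

Fixpoint holds (U : Type) (v : nat -> set U) (f : formula) : Prop :=
  match f with
  | Equal s t => eval v s = eval v t
  | Not f => ~ holds v f
  | And f g => holds v f /\ holds v g
  | Or f g => holds v f \/ holds v g
  | Implies f g => holds v f -> holds v g
  | Exists x f => exists A : set U, holds [eta v with x |-> A] f
  | Forall x f => forall A : set U, holds [eta v with x |-> A] f
  end.

Definition equivalent (f g : formula) : Prop :=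
  forall (U : Type), inhabited U ->
  forall v : nat -> set U, holds v f <-> holds v g.

Fixpoint vars (t : term) : seq nat :=
  match t with
  | Var z => [:: z]
  | Zero | One => [::]
  | Cup s t | Cap s t => vars s ++ vars t
  | Compl s => vars s
  end.

(* [subst x c t] is t(c, z) when t is written t(x, z). *)
Fixpoint subst (x : nat) (c t : term) : term :=
  match t with
  | Var z => if z == x then c else Var z
  | Zero => Zero
  | One => One
  | Cup s t => Cup (subst x c s) (subst x c t)
  | Cap s t => Cap (subst x c s) (subst x c t)
  | Compl s => Compl (subst x c s)
  end.

(* A conjunction of equations in which V does not occur. *)
Fixpoint equations_without (V : nat) (f : formula) : bool :=
  match f with
  | Equal s t => (V \notin vars s) && (V \notin vars t)
  | And f g => equations_without V f && equations_without V g
  | _ => false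
  end.

(* [V_translation V f g] relates f, containing one negated equation t != 0,  *)
(* to g, containing the V-equation V t' = 0 in its place.  Read from left to  *)
(* right it introduces V, read from right to left it removes V; it is a       *)
(* partial function in both directions (see the two lemmas below).  The side  *)
(* conditions say that V is new, i.e. does not occur in f, free or bound.     *)
Inductive V_translation (V : nat) : formula -> formula -> Prop :=
| Vtr_neq t : V \notin vars t ->
    V_translation V (t != 0)%P (Var V `&` ~` t == 0)%P
| Vtr_andl e f g : equations_without V e -> V_translation V f g ->
    V_translation V (e /\ f)%P (e /\ g)%P
| Vtr_andr e f g : equations_without V e -> V_translation V f g ->
    V_translation V (f /\ e)%P (g /\ e)%P
| Vtr_ex x f g : x != V -> V_translation V f g ->
    V_translation V (Exists x f) (Exists x g).

Lemma V_translationN V f g : V_translation V f g ->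
  equations_without V f = false /\ equations_without V g = false.
Proof.
elim=> {f g} [t _|e f g _ _ [/= -> ->]|e f g _ _ [/= -> ->]|//] //=.
  by rewrite inE eqxx.
by rewrite !andbF.
Qed.

Lemma V_translation_functional V f g1 g2 :
  V_translation V f g1 -> V_translation V f g2 -> g1 = g2.
Proof.
move=> H; elim: H g2 => {f g1} [t _|e f g He Hf IH|e f g He Hf IH|x f g _ _ IH] g2 H;
  inversion H; subst => //.
- by rewrite (IH g0).
- by case/V_translationN: H4 => /[!He].
- by case/V_translationN: H4 => /[!He].
- by rewrite (IH g0).
- by rewrite (IH g0).
Qed.

Lemma V_translation_injective V f1 f2 g :
  V_translation V f1 g -> V_translation V f2 g -> f1 = f2.
Proof.
move=> H; elim: H f2 => {f1 g} [t _|e f g He Hf IH|e f g He Hf IH|x f g _ _ IH] f2 H;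
  inversion H; subst => //.
- by rewrite (IH f0).
- by case/V_translationN: H4 => _ /[!He].
- by case/V_translationN: H4 => _ /[!He].
- by rewrite (IH f0).
- by rewrite (IH f0).
Qed.

(* [single_equation f] is the term P such that the conjunction f of equations *)
(* of the form t = 0 reduces to P = 0.                                        *)
Fixpoint single_equation (f : formula) : option term :=
  match f with
  | Equal t Zero => Some t
  | And f g =>
      match single_equation f, single_equation g with
      | Some s, Some t => Some (Cup s t)
      | _, _ => None
      end
  | _ => None
  end.

Definition eliminate (x : nat) (f : formula) : option formula :=
  omap (fun P => (subst x 1 P `&` subst x 0 P == 0)%P) (single_equation f).

(* Main.v *)
Require Import Defs.
From mathcomp Require Import all_boot.
From mathcomp Require Import boolp classical_sets.

(** Everything is decided one point at a time.  Whether a point [u] of [U] lies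
    in the value of a term depends only on which of the sets assigned to the
    variables contain [u], so assigning [A] to [x] has the same effect at [u]
    as substituting [1] for [x] if [u] lies in [A], and [0] otherwise
    ([eval_subst_at]; this is Boole's expansion theorem).  A set [A] solving
    [P(x) = 0] therefore amounts to a choice, at each point, of one of [1] and
    [0] at which [P] does not hold; it exists exactly when no point lies in
    both [P(1)] and [P(0)] ([elimination]).

    The existential formula of the theorem has a conjunction of two equations
    as its matrix, which reduces to the single equation [p `|` V q' = 0], with
    elimination result [(p1 `|` V q1') (p0 `|` V q0') = 0].  Its left side
    multiplies out to
      [p1 p0 `|` V (p1 q0' `|` p0 q1' `|` q1' q0')].
    By de Morgan, [(q1 p1' `|` q0 p0')' = (q1' `|` p1) (q0' `|` p0)], which is
    the factor of [V] here together with [p1 p0]; as [V p1 p0] is absorbed by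
    [p1 p0], this is the term of the stated result.  The translations only
    require [V] to be absent from the terms, and substituting a constant for
    [x] introduces no variable. *)

(** The pointwise form of the substitution lemma: [c] and [A] only have to
    agree at [u], which is what allows the constants [1] and [0] to stand for
    an arbitrary set. *)
Lemma eval_subst_at (U : Type) (v : nat -> set U) (x : nat) (A : set U)
    (c t : term) (u : U) :
  (eval v c u <-> A u) ->
  (eval v (subst x c t) u <-> eval [eta v with x |-> A] t u).
Proof.
move=> cA; elim: t => [z|||s IHs t IHt|s IHs t IHt|s IHs] //=.
- by case: (z == x).
- by split=> -[/IHs ?|/IHt ?]; [left|right|left|right].
- by split=> -[/IHs ? /IHt ?].
- by split=> sNu /IHs.
Qed.

Lemma eval_subst1 (U : Type) (v : nat -> set U) (x : nat) (A : set U)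
    (t : term) (u : U) :
  A u -> (eval v (subst x 1 t) u <-> eval [eta v with x |-> A] t u).
Proof. by move=> Au; apply: eval_subst_at; split. Qed.

Lemma eval_subst0 (U : Type) (v : nat -> set U) (x : nat) (A : set U)
    (t : term) (u : U) :
  ~ A u -> (eval v (subst x 0 t) u <-> eval [eta v with x |-> A] t u).
Proof. by move=> nAu; apply: eval_subst_at; split. Qed.

Lemma equivalent_trans (f g h : formula) :
  equivalent f g -> equivalent g h -> equivalent f h.
Proof. by move=> fg gh U U0 v; rewrite (fg U U0 v); apply: gh. Qed.

Lemma equivalent_Exists (x : nat) (f g : formula) :
  equivalent f g -> equivalent (Exists x f) (Exists x g).
Proof.
by move=> fg U U0 v; split=> -[A fA]; exists A; apply/(fg U U0).
Qed.

Lemma equivalent_eq0 (s t : term) :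
  (forall (U : Type) (v : nat -> set U) u, eval v s u <-> eval v t u) ->
  equivalent (s == 0)%P (t == 0)%P.
Proof.
move=> st U _ v /=.
by have -> : eval v s = eval v t by apply/seteqP; split=> u /st.
Qed.

Lemma equivalent_cup_eq0 (s t : term) :
  equivalent (s `|` t == 0)%P (s == 0 /\ t == 0)%P.
Proof. by move=> U _ v /=; rewrite setU_eq0. Qed.

Lemma single_equation_equivalent (f : formula) (P : term) :
  single_equation f = Some P -> equivalent f (P == 0)%P.
Proof.
elim: f P => [s []||f IHf g IHg||||] //=.
  by move=> P [<-].
move=> P; case: single_equation IHf => // s IHf.
case: single_equation IHg => // t IHg [<-] U U0 v.
have fs := IHf s erefl U U0 v; have gt := IHg t erefl U U0 v.
by rewrite (equivalent_cup_eq0 s t U U0 v) /= fs gt.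
Qed.

(** Boole's elimination.  The largest solution, if there is one, is the
    complement of [P(1)]: a point can be put in [x] exactly when [P(1)] does
    not hold there, and a point left out lies in [P(1)], hence not in [P(0)]. *)
Lemma elimination (x : nat) (P : term) :
  equivalent (Exists x (P == 0)%P) (subst x 1 P `&` subst x 0 P == 0)%P.
Proof.
move=> U _ v /=; split=> [[A PA0]|P10].
  apply/seteqP; split=> // u [P1u P0u]; rewrite -PA0.
  by have [Au|Au] := pselect (A u); [apply/eval_subst1|apply/eval_subst0].
pose A := (~` eval v (subst x 1 P))%classic.
exists A; apply/seteqP; split=> // u PAu.
have [Au|nAu] := pselect (A u).
  by case: (Au); apply/(eval_subst1 U v x A P u Au).
rewrite -P10; split; first exact: contrapT.
exact/(eval_subst0 U v x A P u nAu).
Qed.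

Lemma eliminate_equivalent (x : nat) (f e : formula) :
  eliminate x f = Some e -> equivalent (Exists x f) e.
Proof.
rewrite /eliminate; case fP: single_equation => [P|] //= [<-].
apply: equivalent_trans (elimination x P).
exact/equivalent_Exists/single_equation_equivalent.
Qed.

Lemma notin_vars_subst (V x : nat) (c t : term) :
  V \notin vars c -> V \notin vars t -> V \notin vars (subst x c t).
Proof.
move=> Vc; elim: t => [z|||s IHs t IHt|s IHs t IHt|s IHs] //=.
- by case: (z == x).
- by rewrite !mem_cat !negb_or => /andP[/IHs -> /IHt].
- by rewrite !mem_cat !negb_or => /andP[/IHs -> /IHt].
Qed.

Theorem theorem7p3 (x V : nat) (y : seq nat) (p q : term)
    (hxy : x \notin y) (hVx : V != x) (hVy : V \notin y)
    (hp : {subset vars p <= x :: y}) (hq : {subset vars q <= x :: y}) :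
  let p1 := subst x 1 p in let p0 := subst x 0 p in
  let q1 := subst x 1 q in let q0 := subst x 0 q in
  let r := (q1 `&` ~` p1 `|` q0 `&` ~` p0)%P in
  let body := (p == 0 /\ Var V `&` ~` q == 0)%P in
  let result := (p1 `&` p0 `|` Var V `&` ~` r == 0)%P in
  let split_result := (p1 `&` p0 == 0 /\ Var V `&` ~` r == 0)%P in
  [/\ V_translation V (Exists x (p == 0 /\ q != 0)%P) (Exists x body),
      exists2 e, eliminate x body = Some e & equivalent e result,
      equivalent (Exists x body) result,
      equivalent result split_result
    & V_translation V (p1 `&` p0 == 0 /\ r != 0)%P split_result].
Proof.
move=> p1 p0 q1 q0 r body result split_result.
have Vxy : V \notin x :: y by rewrite inE negb_or hVx.
have Vp : V \notin vars p by apply: contra Vxy => /hp.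
have Vq : V \notin vars q by apply: contra Vxy => /hq.
have Vsub c t : vars c = [::] -> V \notin vars t -> V \notin vars (subst x c t).
  by move=> c0; apply: notin_vars_subst; rewrite c0.
pose e := ((p1 `|` Var V `&` ~` q1) `&` (p0 `|` Var V `&` ~` q0) == 0)%P.
have body_e : eliminate x body = Some e by rewrite /eliminate /= (negPf hVx).
have e_result : equivalent e result.
  apply: equivalent_eq0 => U v u /=.
  (* At a point, the Boolean identity is a propositional tautology in
     membership; de Morgan needs the cases of [p1], [p0], [q1], [q0] decided. *)
  rewrite /setU /setI /setC /mkset /=.
  have [] := (pselect (eval v p1 u), pselect (eval v p0 u)).
  have [] := (pselect (eval v q1 u), pselect (eval v q0 u)).
  by move=> [] ? [] ? [] ? [] ?; tauto.
split.
- apply: Vtr_ex; first by rewrite eq_sym.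
  by apply: Vtr_andl; [rewrite /= Vp|apply: Vtr_neq].
- by exists e.
- exact: equivalent_trans (eliminate_equivalent _ _ _ body_e) e_result.
- exact: equivalent_cup_eq0.
- apply: Vtr_andl; first by rewrite /= mem_cat negb_or !Vsub.
  by apply: Vtr_neq; rewrite /= !mem_cat !negb_or !Vsub.
Qed.
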